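(* Let $p\geq 1$. The $p$-energy of a vertex is in the core of the $p$-energy game. That is, for every graph $G=(V,E)$ with $V=\{v_1,\dots,v_n\}$, setting $w_p(S)=\mathcal{E}_p(I(S))$ for $S\subset V$, the vector $(\mathcal{E}_p(v_1),\dots,\mathcal{E}_p(v_n))$ belongs to the core of the game $(V,w_p)$.
   Context: Graphs are finite, simple and undirected. For a graph $G$ with vertices $v_1,\dots,v_n$, the adjacency matrix $A(G)$ is the $n\times n$ matrix with $A_{ij}=1$ if $v_i$ and $v_j$ are adjacent and $A_{ij}=0$ otherwise. For a matrix $M$, $|M|=(MM^* )^{1/2}$. The $p$-energy of $G$ is $\mathcal{E}_p(G)=\operatorname{Tr}(|A(G)|^p)$ (the empty graph has $p$-energy $0$), and the $p$-energy of the vertex $v_i$ of $G$ is $\mathcal{E}_p(v_i)=(|A(G)|^p)_{ii}$. For $S\subset V$, $I(S)$ denotes the subgraph of $G$ induced by $S$. The core of a game $(N,w)$ (with $N=\{1,\dots,n\}$, $w:2^N\to\mathbb{R}$, $w(\emptyset)=0$) is the set of vectors $x\in\mathbb{R}^n$ such that $\sum_{i\in S}x_i\geq w(S)$ for each $S\subset N$ and $\sum_{i\in N}x_i=w(N)$. *)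

(* Defs.v *)
From HB Require Import structures.
From mathcomp Require Import all_boot all_order all_algebra.
From mathcomp Require Import complex.
From mathcomp Require Import boolp classical_sets reals exp.

Set Implicit Arguments.
Unset Strict Implicit.
Unset Printing Implicit Defensive.

Import Order.TTheory GRing.Theory Num.Theory.

Local Open Scope ring_scope.
Local Open Scope complex_scope.
Local Open Scope sesquilinear_scope.

Record graph (n : nat) := Graph {
  adj :> rel 'I_n;
  adj_sym : symmetric adj;
  adj_irrefl : irreflexive adj
}.

(* The vertices of S are renumbered 0, ..., #|S|.-1 by their order in enum S. *)
Definition induced_adj n (G : graph n) (S : {set 'I_n}) : rel 'I_#|S| :=
  fun i j => G (enum_val i) (enum_val j).

Lemma induced_sym n (G : graph n) S : symmetric (@induced_adj n G S).
Proof. by move=> i j; exact: adj_sym. Qed.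

Lemma induced_irrefl n (G : graph n) S : irreflexive (@induced_adj n G S).
Proof. by move=> i; exact: adj_irrefl. Qed.

Definition induced n (G : graph n) (S : {set 'I_n}) : graph #|S| :=
  Graph (@induced_sym n G S) (@induced_irrefl n G S).

(* Real power of a positive semidefinite matrix B by functional calculus:
   spectralmx B is a unitary matrix P with B = P^-1 diag(d) P, where
   d = spectral_diag B is real and nonnegative, and B^s = P^-1 diag(d^s) P.
   The value is only meaningful for positive semidefinite B. By powmx_diag it
   does not depend on the chosen diagonalization. *)
Definition powmx (R : realType) n (B : 'M[R[i]]_n) (s : R) : 'M[R[i]]_n :=
  invmx (spectralmx B)
    *m diag_mx (map_mx (fun z => (complex.Re z `^ s)%:C) (spectral_diag B))
    *m spectralmx B.

Definition absmx (R : realType) m n (M : 'M[R[i]]_(m, n)) : 'M[R[i]]_m :=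
  powmx (M *m M^t*) 2^-1.

Definition adjmx (R : realType) n (G : graph n) : 'M[R[i]]_n :=
  \matrix_(i, j) (G i j)%:R.

Definition abs_adjmx_pow (R : realType) n (G : graph n) (p : R) : 'M[R[i]]_n :=
  powmx (absmx (adjmx R G)) p.

(* The trace and the diagonal entries below are real numbers embedded in R[i]
   (see energyE and vertex_energyE), so complex.Re only changes their type. *)
Definition energy (R : realType) n (G : graph n) (p : R) : R :=
  complex.Re (\tr (abs_adjmx_pow G p)).

Definition vertex_energy (R : realType) n (G : graph n) (p : R) (i : 'I_n) : R :=
  complex.Re (abs_adjmx_pow G p i i).

Record game (R : realType) (n : nat) := Game {
  worth :> {set 'I_n} -> R;
  worth0 : worth finset.set0 = 0
}.

Definition core (R : realType) n (w : game R n) : set 'rV[R]_n :=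
  [set x | (forall S : {set 'I_n}, w S <= \sum_(i in S) x 0 i)
           /\ \sum_i x 0 i = w [set: 'I_n]%SET].

Lemma energy_induced0 (R : realType) n (G : graph n) (p : R) :
  energy (induced G finset.set0) p = 0.
Proof.
rewrite /energy /mxtrace big1 // => i _.
by have := ltn_ord i; rewrite [X in (_ < X)%N]cards0.
Qed.

Definition energy_game (R : realType) n (G : graph n) (p : R) : game R n :=
  @Game R n (fun S => energy (induced G S) p) (energy_induced0 G p).

Lemma powmx_diag (R : realType) n (U : 'M[R[i]]_n) (d : 'rV[R[i]]_n) (s : R) :
  U \is unitarymx ->
  powmx (U^t* *m diag_mx d *m U) s =
  U^t* *m diag_mx (map_mx (fun z => (complex.Re z `^ s)%:C) d) *m U.
Proof.
move=> Uu; set B := U^t* *m _ *m U.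
have Ut : U^t* *m U = 1%:M by rewrite -invmx_unitary // mulVmx ?unitarymx_unit.
have UU : U *m U^t* = 1%:M by apply/unitarymxP.
have Bn : B \is normalmx.
  have conjB e1 e2 : (U^t* *m diag_mx e1 *m U) *m (U^t* *m diag_mx e2 *m U)
      = U^t* *m (diag_mx e1 *m diag_mx e2) *m U.
    by rewrite !mulmxA -[X in X *m diag_mx e2 *m U]mulmxA UU mulmx1.
  have BtE : B^t* = U^t* *m diag_mx (map_mx Num.conj d) *m U.
    by rewrite /B !trmx_mul !map_mxM /= trmxCK tr_diag_mx map_diag_mx mulmxA.
  by apply/normalmxP; rewrite BtE !conjB diag_mxC.
have BE := orthomx_spectralP Bn.
rewrite /powmx; set P := spectralmx B in BE *; set D := spectral_diag B in BE *.
have Pu : P \is unitarymx by exact: spectral_unitarymx.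
have Pi : P *m invmx P = 1%:M by rewrite mulmxV // unitarymx_unit.
have iP : invmx P *m P = 1%:M by rewrite mulVmx // unitarymx_unit.
have W : diag_mx D *m (P *m U^t*) = (P *m U^t*) *m diag_mx d.
  have : P *m B *m U^t* = P *m B *m U^t* by [].
  rewrite {1}BE {1}/B !mulmxA Pi mul1mx => ->.
  by rewrite -(mulmxA _ U) UU mulmx1.
set f := map_mx _ D; set g := map_mx _ d.
have W' : diag_mx f *m (P *m U^t*) = (P *m U^t*) *m diag_mx g.
  apply/matrixP => i j; move/matrixP/(_ i j): W.
  rewrite !mul_diag_mx !mul_mx_diag !mxE; set w := \sum_k _.
  rewrite mulrC => h; rewrite mulrC.
  have [->|w0] := eqVneq w 0; first by rewrite !mul0r.
  by rewrite (mulfI w0 h).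
rewrite -[LHS]mulmx1 -Ut mulmxA -(mulmxA (_ *m diag_mx f)).
by rewrite -(mulmxA (invmx P)) W' !mulmxA iP mul1mx.
Qed.

Lemma powmx_diag_real (R : realType) n (B : 'M[R[i]]_n) (s : R) (i : 'I_n) :
  (complex.Re (powmx B s i i))%:C = powmx B s i i.
Proof.
rewrite /powmx invmx_unitary ?spectral_unitarymx //.
set P := spectralmx B; set d := map_mx _ _.
apply: RRe_real; rewrite mxE; apply: sum_real => k _.
rewrite mul_mx_diag !mxE mulrAC; apply: realM.
  by rewrite mulrC ger0_real // mul_conjC_ge0.
by apply/complex_realP; eexists.
Qed.

Lemma energyE (R : realType) n (G : graph n) (p : R) :
  (energy G p)%:C = \tr (abs_adjmx_pow G p).
Proof.
apply: RRe_real; apply: sum_real => i _.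
by rewrite /abs_adjmx_pow -powmx_diag_real; apply/complex_realP; eexists.
Qed.

Lemma vertex_energyE (R : realType) n (G : graph n) (p : R) (i : 'I_n) :
  (vertex_energy G p i)%:C = abs_adjmx_pow G p i i.
Proof. exact: powmx_diag_real. Qed.

Lemma absmx_sqr (R : realType) m n (M : 'M[R[i]]_(m, n)) : absmx M *m absmx M = M *m M^t*.
Proof.
rewrite /absmx /powmx; set B := M *m _.
have Bh : B^t* = B by rewrite /B trmx_mul map_mxM /= trmxCK.
have Bn : B \is normalmx by apply/normalmxP; rewrite Bh.
have BE := orthomx_spectralP Bn.
set P := spectralmx B in BE *; set D := spectral_diag B in BE *.
have Pu : P \is unitarymx by exact: spectral_unitarymx.
have Pi : P *m invmx P = 1%:M by rewrite mulmxV // unitarymx_unit.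
have DE : diag_mx D = (P *m M) *m (P *m M)^t*.
  rewrite trmx_mul map_mxM /= mulmxA -(mulmxA P M) -/B BE -!invmx_unitary //.
  by rewrite !mulmxA Pi mul1mx -mulmxA Pi mulmx1.
rewrite [RHS]BE !mulmxA -(mulmxA _ P) Pi mulmx1 -[X in X *m P = _]mulmxA mulmx_diag.
congr (_ *m diag_mx _ *m _); apply/rowP => j; rewrite !mxE.
have D0 : 0 <= D 0 j.
  move/matrixP/(_ j j): DE; rewrite !mxE eqxx mulr1n => ->.
  by apply: sumr_ge0 => k _; rewrite !mxE mul_conjC_ge0.
have Re0 : 0 <= complex.Re (D 0 j) by move: D0; rewrite lecE => /andP[].
rewrite -rmorphM /= -expr2 -powR_mulrn ?powR_ge0 // -powRrM mulVf ?pnatr_eq0 //.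
by rewrite powRr1 // RRe_real // ger0_real.
Qed.

(* Main.v *)
(* The adjacency matrix of an induced subgraph is a compression V A V^* of the
   Hermitian matrix A = A(G), where V V^* = 1. Diagonalizing A and V A V^* by
   unitaries U and W, each eigenvalue of the compression is an average
   s_j = sum_k |X_jk|^2 r_k of the eigenvalues of A, with X = W V U^* and
   X X^* = 1. Jensen's inequality for |x|^p gives
   Tr |V A V^*|^p <= Tr (V |A|^p V^* ), and the right-hand side is the sum of
   the vertex energies over S. *)
Require Import Defs.
From mathcomp Require Import all_boot all_order all_algebra.
From mathcomp Require Import complex exp lra.
From mathcomp Require Import classical_sets reals.

Import Order.TTheory GRing.Theory Num.Theory.

Set Implicit Arguments.
Unset Strict Implicit.
Unset Printing Implicit Defensive.

Local Open Scope ring_scope.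
Local Open Scope complex_scope.
Local Open Scope sesquilinear_scope.

(* Young's inequality for the conjugate exponents p and p / (p - 1). *)
Lemma powR_tangent (R : realType) (p x y : R) : 1 <= p -> 0 <= x -> 0 <= y ->
  p * (x * y `^ (p - 1)) <= x `^ p + (p - 1) * y `^ p.
Proof.
move=> p1 x0 y0; have p0 : 0 < p by lra.
(* At [p = 1] there is no finite conjugate exponent; both sides equal [x], because [powR] gives y^0
   = 1 even for y = 0. *)
have [->|pN1] := eqVneq p 1.
  by rewrite subrr powRr0 powRr1 // mulr1 mul1r mul0r addr0.
have pm1 : 0 < p - 1 by rewrite subr_gt0 lt_neqAle eq_sym pN1.
pose q := p / (p - 1).
have q0 : 0 < q by rewrite divr_gt0.
have pq : p^-1 + q^-1 = 1.
  by rewrite /q invf_div mulrBl mul1r divff ?gt_eqF // addrC subrK.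
(* Young is applied to x and y^(p-1), whose q-th power is y^p; multiplying by p turns 1/q into p -
   1. *)
have := conjugate_powR x0 (powR_ge0 y (p - 1)) p0 q0 pq.
rewrite -powRrM [(p - 1) * q]mulrC /q divfK ?gt_eqF //.
rewrite -(ler_pM2l p0) => /le_trans; apply.
rewrite mulrDr invf_div mulrCA divff ?gt_eqF // mulr1 lerD2l.
by rewrite mulrCA [p * _]mulrC divfK ?gt_eqF // mulrC.
Qed.

Lemma jensen_norm_powR (R : realType) (I : finType) (w x : I -> R) (p : R) :
  1 <= p -> (forall i, 0 <= w i) -> \sum_i w i = 1 ->
  `|\sum_i w i * x i| `^ p <= \sum_i w i * `|x i| `^ p.
Proof.
move=> p1 w0 w1; have p0 : 0 <= p by lra.
pose y := \sum_i w i * `|x i|.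
have y0 : 0 <= y by apply: sumr_ge0 => i _; rewrite mulr_ge0.
apply: (@le_trans _ _ (y `^ p)).
  apply: ge0_ler_powR; rewrite ?nnegrE //.
  apply: le_trans (ler_norm_sum _ _ _) _; apply: ler_sum => i _.
  by rewrite normrM ger0_norm.
have yp : y * y `^ (p - 1) = y `^ p.
  have [->|yN0] := eqVneq y 0; first by rewrite mul0r powR0 // gt_eqF //; lra.
  rewrite -[X in X * _]powRr1 // -powRD ?yN0 ?implybT //.
  by congr (_ `^ _); lra.
(* Average the tangent inequality at y = sum_i w i |x i|. *)
have : \sum_i w i * (p * (`|x i| * y `^ (p - 1))) <=
       \sum_i w i * (`|x i| `^ p + (p - 1) * y `^ p).
  by apply: ler_sum => i _; apply: ler_wpM2l => //; apply: powR_tangent.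
have -> : \sum_i w i * (p * (`|x i| * y `^ (p - 1))) = p * y `^ p.
  rewrite -yp /y mulr_suml mulr_sumr.
  by apply: eq_bigr => i _; rewrite mulrCA !mulrA.
under eq_bigr do rewrite mulrDr.
rewrite big_split /= -mulr_suml w1 mul1r; lra.
Qed.

Definition real_diag (R : realType) n (r : 'rV[R]_n) : 'M[R[i]]_n :=
  diag_mx (map_mx (fun x => x%:C) r).

(** By [powmx_diag] any unitary diagonalization may be used, so the square root and the p-th power
    both act on the given eigenvalues, and the root of r^2 is |r|. *)
Lemma pow_abs_spectral (R : realType) n (U : 'M[R[i]]_n) (r : 'rV[R]_n) (p : R) :
  U \is unitarymx ->
  powmx (absmx (U^t* *m real_diag r *m U)) p =
  U^t* *m real_diag (map_mx (fun x => `|x| `^ p) r) *m U.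
Proof.
move=> Uu; have UU : U *m U^t* = 1%:M by apply/unitarymxP.
rewrite /absmx.
have -> : (U^t* *m real_diag r *m U) *m (U^t* *m real_diag r *m U)^t* =
    U^t* *m real_diag (map_mx (fun x => x ^+ 2) r) *m U.
  rewrite !trmx_mul !map_mxM /= trmxCK tr_diag_mx map_diag_mx !mulmxA.
  rewrite -(mulmxA _ U) UU mulmx1 -(mulmxA (U^t*)) mulmx_diag.
  congr (_ *m diag_mx _ *m _); apply/rowP => j; rewrite !mxE.
  by rewrite [X in _ * X](conjc_real (r 0 j)) -rmorphM expr2.
rewrite /real_diag !powmx_diag //; congr (_ *m diag_mx _ *m _).
apply/rowP => j; rewrite !mxE /= -real_normK ?num_real //.
by rewrite -powR_mulrn // -!powRrM mulrA mulfV ?pnatr_eq0 // mul1r.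
Qed.

Lemma hermitian_spectral (R : realType) n (A : 'M[R[i]]_n) : A^t* = A ->
  exists (U : 'M[R[i]]_n) (r : 'rV[R]_n),
    U \is unitarymx /\ A = U^t* *m real_diag r *m U.
Proof.
(* Real parts lose nothing here: a Hermitian matrix has real spectrum. *)
move=> AA; exists (spectralmx A), (map_mx (@complex.Re R) (spectral_diag A)).
have Pu := spectral_unitarymx A; split=> //.
have Ah : A \is hermsymmx by apply/is_hermitianmxP; rewrite expr0 scale1r AA.
have /orthomx_spectralP := hermitian_normalmx Ah.
rewrite invmx_unitary // => {1}->; congr (_ *m diag_mx _ *m _).
apply/rowP => j; rewrite !mxE RRe_real //.
by have /mxOverP := hermitian_spectral_diag_real Ah; apply.
Qed.

Lemma conj_real_diag_entry (R : realType) m n (X : 'M[R[i]]_(m, n))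
    (r : 'rV[R]_n) (j : 'I_m) :
  (X *m real_diag r *m X^t*) j j =
  (\sum_k complex.Re (X j k * (X j k)^*) * r 0 k)%:C.
Proof.
rewrite mxE rmorph_sum; apply: eq_bigr => k _.
rewrite mul_mx_diag !mxE mulrAC rmorphM /= RRe_real //.
by rewrite ger0_real // mul_conjC_ge0.
Qed.

(** For rectangular [V], [unitarymx] means orthonormal rows. A general [V] allows use both for
    restricting to S and for going back from the full vertex set. *)
Lemma trace_compression (R : realType) n m (V : 'M[R[i]]_(m, n))
    (A : 'M[R[i]]_n) (p : R) :
  1 <= p -> A^t* = A -> V \is unitarymx ->
  \tr (powmx (absmx (V *m A *m V^t*)) p) <=
  \tr (V *m powmx (absmx A) p *m V^t*).
Proof.
move=> p1 AA Vu; have VV : V *m V^t* = 1%:M by apply/unitarymxP.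
set B := V *m A *m V^t*.
have BB : B^t* = B.
  by rewrite /B !trmx_mul !map_mxM /= trmxCK AA mulmxA.
have [U [r [Uu AE]]] := hermitian_spectral AA.
have [W [s [Wu BE]]] := hermitian_spectral BB.
have WW : W *m W^t* = 1%:M by apply/unitarymxP.
have tW : W^t* *m W = 1%:M by rewrite -invmx_unitary // mulVmx ?unitarymx_unit.
have [X XE] : exists X, X = W *m V *m U^t* by eexists.
have Xt : X^t* = U *m V^t* *m W^t*.
  by rewrite XE !trmx_mul !map_mxM /= trmxCK mulmxA.
have XX : X *m X^t* = 1%:M.
  by rewrite Xt XE !mulmxA mulmxKtV // -(mulmxA W) VV mulmx1.
have sE : real_diag s = X *m real_diag r *m X^t*.
  rewrite Xt XE !mulmxA -(mulmxA (W *m V)) -(mulmxA (W *m V)) -AE.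
  rewrite -(mulmxA W) -(mulmxA W) -/B BE !mulmxA WW mul1mx.
  by rewrite -mulmxA WW mulmx1.
rewrite {1}BE {1}AE !pow_abs_spectral //.
set ds := real_diag _; set dr := real_diag (map_mx _ r).
(* Cyclicity of the trace removes [W] on the left and inserts it on the right, so that the traces
   can be compared one diagonal entry at a time. *)
rewrite [X in X <= _]mxtrace_mulC mulmxA WW mul1mx.
have -> : \tr (V *m (U^t* *m dr *m U) *m V^t*) = \tr (X *m dr *m X^t*).
  by rewrite Xt XE !mulmxA [RHS]mxtrace_mulC !mulmxA tW mul1mx.
have w0 j k : 0 <= complex.Re (X j k * (X j k)^*).
  by have := mul_conjC_ge0 (X j k); rewrite lecE => /andP[].
rewrite /mxtrace; apply: ler_sum => j _.
rewrite conj_real_diag_entry /ds /real_diag !mxE eqxx mulr1n lecR.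
under eq_bigr do rewrite [map_mx _ _ _ _]mxE.
have -> : s 0 j = \sum_k complex.Re (X j k * (X j k)^*) * r 0 k.
  have /matrixP/(_ j j) := sE; rewrite conj_real_diag_entry.
  by rewrite /real_diag !mxE eqxx mulr1n => -[].
apply: jensen_norm_powR => //.
(* The weights sum to 1 because row [j] of [X] is a unit vector. *)
rewrite -raddf_sum /=.
have -> : \sum_k X j k * (X j k)^* = (X *m X^t* ) j j.
  by rewrite [RHS]mxE; apply: eq_bigr => k _; rewrite !mxE.
by rewrite XX mxE eqxx.
Qed.

Lemma adjmx_hermitian (R : realType) n (G : graph n) :
  (adjmx R G)^t* = adjmx R G.
Proof. by apply/matrixP => i j; rewrite !mxE conjC_nat adj_sym. Qed.

(** The coordinate projection onto S; [enum_val] matches the renumbering in [induced_adj]. *)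
Definition restr_mx (R : realType) n (S : {set 'I_n}) : 'M[R[i]]_(#|S|, n) :=
  rowsub enum_val 1%:M.

Lemma restr_conjE (R : realType) n (S : {set 'I_n}) (M : 'M[R[i]]_n) :
  restr_mx R S *m M *m (restr_mx R S)^t* = mxsub enum_val enum_val M.
Proof.
have -> : (restr_mx R S)^t* = colsub enum_val 1%:M.
  by apply/matrixP => i j; rewrite !mxE conjC_nat eq_sym.
by rewrite -rowsubE mulmx_colsub mulmx1; apply/matrixP => i j; rewrite !mxE.
Qed.

Lemma restr_unitary (R : realType) n (S : {set 'I_n}) :
  restr_mx R S \is unitarymx.
Proof.
apply/unitarymxP; rewrite -[X in X *m _]mulmx1 restr_conjE.
by apply/matrixP => i j; rewrite !mxE (inj_eq enum_val_inj).
Qed.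

Lemma adjmx_induced (R : realType) n (G : graph n) (S : {set 'I_n}) :
  adjmx R (induced G S) = restr_mx R S *m adjmx R G *m (restr_mx R S)^t*.
Proof. by rewrite restr_conjE; apply/matrixP => i j; rewrite !mxE. Qed.

Lemma sum_vertex_energy (R : realType) n (G : graph n)
    (S : {set 'I_n}) (p : R) :
  (\sum_(i in S) vertex_energy G p i)%:C =
  \tr (restr_mx R S *m abs_adjmx_pow G p *m (restr_mx R S)^t*).
Proof.
rewrite restr_conjE rmorph_sum /mxtrace [LHS]big_enum_val /=.
by apply: eq_bigr => i _; rewrite [RHS]mxE vertex_energyE.
Qed.

Lemma energy_induced_le (R : realType) n (G : graph n)
    (S : {set 'I_n}) (p : R) :
  1 <= p -> energy (induced G S) p <= \sum_(i in S) vertex_energy G p i.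
Proof.
move=> p1; rewrite -lecR energyE sum_vertex_energy /abs_adjmx_pow adjmx_induced.
by apply: trace_compression => //; [exact: adjmx_hermitian|exact: restr_unitary].
Qed.

(** The sizes [#|[set: 'I_n]|] and [n] are equal but not convertible, so this product is computed
    entrywise, reindexing the sum along [enum_val]. *)
Lemma restr_setT (R : realType) n :
  (restr_mx R [set: 'I_n])^t* *m restr_mx R [set: 'I_n] = 1%:M.
Proof.
apply/matrixP => i j; rewrite !mxE.
under eq_bigr do rewrite !mxE conjC_nat.
rewrite -(big_enum_val (fun k => (k == i)%:R * (k == j)%:R)) /=.
rewrite (bigD1 i) ?inE //= eqxx mul1r big1 ?addr0 // => k /andP[_ /negPf->].
by rewrite mul0r.
Qed.

(* The inclusion of the full vertex set is unitary on both sides, so G is in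
   turn a compression of its induced copy, and the inequality reverses. *)
Lemma energy_induced_setT_ge (R : realType) n (G : graph n) (p : R) : 1 <= p ->
  \sum_i vertex_energy G p i <= energy (induced G [set: 'I_n]) p.
Proof.
move=> p1; have -> : \sum_i vertex_energy G p i = energy G p.
  by rewrite /energy /mxtrace raddf_sum.
rewrite -lecR !energyE /abs_adjmx_pow.
have := restr_setT R n; set V := restr_mx R _ => VV.
have AE : adjmx R G = V^t* *m adjmx R (induced G [set: 'I_n]) *m V^t*^t*.
  by rewrite adjmx_induced trmxCK -/V !mulmxA VV mul1mx -mulmxA VV mulmx1.
rewrite {1}AE; apply: le_trans (trace_compression p1 _ _) _.
- exact: adjmx_hermitian.
- by apply/unitarymxP; rewrite trmxCK.
rewrite mxtrace_mulC mulmxA trmxCK.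
by rewrite (unitarymxP (restr_unitary R [set: 'I_n])) mul1mx.
Qed.

Theorem theorem4p9 (R : realType) (p : R) (hp : 1 <= p) (n : nat) (G : graph n) :
  core (energy_game G p) (\row_(i < n) vertex_energy G p i).
Proof.
split=> [S|].
  under eq_bigr do rewrite mxE.
  exact: energy_induced_le.
under eq_bigr do rewrite mxE.
(* The remaining inequality is the coalition bound for the full vertex set. *)
apply/eqP; rewrite eq_le energy_induced_setT_ge //=.
have := energy_induced_le G [set: 'I_n] hp.
by under [X in _ <= X -> _]eq_bigl do rewrite inE.
Qed.
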